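(* Let $F:\mathbb{R}^d\to\mathbb{R}$ satisfy Assumptions 1 and 2 (stated in the context) with constants $L$ and $\tau$, let $\epsilon>0$, $p^t\in(0,1)$, and $0<\sigma<\frac{1}{35}\sqrt{\frac{\epsilon\min(p^t,1-p^t)}{\tau d^3\max(L,1)}}$. Then for every $\theta\in\mathbb{R}^d$ the baseline and ASEBO gradient estimators satisfy $$\left\|\mathbb{E}_{\mathbf{g}\sim\mathcal{N}(0,\mathbf{I}_d)}\left[\widehat{\nabla}^{\mathrm{AT,base}}_{\mathrm{MC},k=1}F_\sigma(\theta)\right]-\nabla F(\theta)\right\|\le\epsilon \quad\text{and}\quad \left\|\mathbb{E}_{\mathbf{g}\sim\widehat{P}}\left[\widehat{\nabla}^{\mathrm{AT,asebo}}_{\mathrm{MC},k=1}F_\sigma(\theta)\right]-\nabla F(\theta)\right\|\le\epsilon .$$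
   Context: Norms of vectors are Euclidean. Assumption 1: $F$ is $L$-Lipschitz, i.e. $|F(\theta)-F(\theta')|\le L\|\theta-\theta'\|_2$ for all $\theta,\theta'\in\mathbb{R}^d$. Assumption 2: $F$ has a $\tau$-smooth third order derivative tensor with respect to $\sigma>0$: for all $\theta,\mathbf{g}\in\mathbb{R}^d$, $F(\theta+\sigma\mathbf{g})=F(\theta)+\sigma\nabla F(\theta)^\top\mathbf{g}+\frac{\sigma^2}{2}\mathbf{g}^\top H(\theta)\mathbf{g}+\frac16\sigma^3F'''(\theta)[\mathbf{v},\mathbf{v},\mathbf{v}]$ for some $\mathbf{v}\in\mathbb{R}^d$ with $\|\mathbf{v}\|_2\le\|\mathbf{g}\|_2$ and $|F'''(\theta)[\mathbf{v},\mathbf{v},\mathbf{v}]|\le\tau\|\mathbf{v}\|_2^3\le\tau\|\mathbf{g}\|_2^3$; here $H$ is the Hessian and $F'''$ the third derivative tensor of $F$. $\mathcal{L}^{\mathrm{ES}}_{\mathrm{active}}\subset\mathbb{R}^d$ is a linear subspace of dimension $r$ and $\mathcal{L}^{\mathrm{ES},\perp}_{\mathrm{active}}$ is its orthogonal complement; $\mathbf{U}^{\mathrm{act}}\in\mathbb{R}^{d\times r}$ and $\mathbf{U}^\perp\in\mathbb{R}^{d\times(d-r)}$ have as columns orthonormal bases of these two subspaces. $\widehat{P}$ is the mixture distribution: with probability $p^t$, $\mathbf{g}\sim\mathcal{N}(0,\mathbf{U}^{\mathrm{act}}(\mathbf{U}^{\mathrm{act}})^\top)$, and with probability $1-p^t$,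 $\mathbf{g}\sim\mathcal{N}(0,\mathbf{U}^\perp(\mathbf{U}^\perp)^\top)$. Put $\mathbf{C}_1=\mathbb{E}_{\mathbf{g}\sim\widehat{P}}[\mathbf{g}\mathbf{g}^\top]=p^t\mathbf{U}^{\mathrm{act}}(\mathbf{U}^{\mathrm{act}})^\top+(1-p^t)\mathbf{U}^\perp(\mathbf{U}^\perp)^\top$. The estimators are $\widehat{\nabla}^{\mathrm{AT,base}}_{\mathrm{MC},k=1}F_\sigma(\theta)=\frac{F(\theta+\sigma\mathbf{g})-F(\theta-\sigma\mathbf{g})}{2\sigma}\mathbf{g}$ with $\mathbf{g}\sim\mathcal{N}(0,\mathbf{I}_d)$, and $\widehat{\nabla}^{\mathrm{AT,asebo}}_{\mathrm{MC},k=1}F_\sigma(\theta)=\mathbf{C}_1^{-1}\frac{F(\theta+\sigma\mathbf{g})-F(\theta-\sigma\mathbf{g})}{2\sigma}\mathbf{g}$ with $\mathbf{g}\sim\widehat{P}$. *)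

(* Defs.v *)
From mathcomp Require Import all_boot all_order all_algebra.
From mathcomp Require Import all_classical all_reals all_analysis.

Set Implicit Arguments.
Unset Strict Implicit.
Unset Printing Implicit Defensive.
Import Order.TTheory GRing.Theory Num.Theory.
Import numFieldNormedType.Exports.
Local Open Scope classical_set_scope.
Local Open Scope ring_scope.

Section Euclidean.
Context {R : realType} {d : nat}.
Implicit Types (u v : 'cV[R]_d) (L : {vspace 'cV[R]_d}).

Definition dot u v : R := (u^T *m v) ord0 ord0.

(* The norm `|v| of the library is the sup norm; it induces the same topology
   and the same differentiability notion, but bounds must use this one. *)
Definition norm2 v : R := Num.sqrt (dot v v).

Definition orthocomplement (L Lperp : {vspace 'cV[R]_d}) : Prop :=
  forall v, v \in Lperp <-> (forall u, u \in L -> dot u v = 0).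

Definition orthonormal_basis (k : nat) L (U : 'M[R]_(d, k)) : Prop :=
  basis_of L [seq col j U | j : 'I_k] /\
  forall i j : 'I_k, dot (col i U) (col j U) = (i == j)%:R.

End Euclidean.

Section Derivatives.
Context {R : realType} {d : nat}.
Implicit Types (F : 'cV[R]_d -> R) (theta : 'cV[R]_d).

Definition partial (i : 'I_d) F : 'cV[R]_d -> R :=
  fun theta => 'D_(delta_mx i ord0) F theta.

Definition gradient F theta : 'cV[R]_d := \col_i partial i F theta.

Definition hessian F theta : 'M[R]_d :=
  \matrix_(i, j) partial j (partial i F) theta.

(* F'''(theta)[u, v, w] *)
Definition third_derivative F theta (u v w : 'cV[R]_d) : R :=
  \sum_(i < d) \sum_(j < d) \sum_(k < d)
    partial k (partial j (partial i F)) theta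
    * u i ord0 * v j ord0 * w k ord0.

(* Three times Frechet differentiability everywhere, componentwise. *)
Definition differentiable3 F : Prop :=
  (forall theta, differentiable F theta) /\
  (forall i theta, differentiable (partial i F) theta) /\
  (forall i j theta, differentiable (partial j (partial i F)) theta).

Definition lipschitz2 (L : R) F : Prop :=
  forall theta theta', `|F theta - F theta'| <= L * norm2 (theta - theta').

Definition smooth3 (tau sigma : R) F : Prop :=
  differentiable3 F /\
  forall theta g : 'cV[R]_d, exists v : 'cV[R]_d,
    F (theta + sigma *: g) =
      F theta + sigma * dot (gradient F theta) g
      + sigma ^+ 2 / 2 * dot g (hessian F theta *m g)
      + 1 / 6 * sigma ^+ 3 * third_derivative F theta v v v /\
    norm2 v <= norm2 g /\
    `|third_derivative F theta v v v| <= tau * norm2 v ^+ 3 /\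
    tau * norm2 v ^+ 3 <= tau * norm2 g ^+ 3.

End Derivatives.

(* R^d with its Borel sigma-algebra *)
Definition borel_cV (R : realType) (d : nat) :=
  g_sigma_algebraType (@open 'cV[R]_d).

Section Gaussian.
Context {R : realType} {d : nat}.
Implicit Types P Q : probability (borel_cV R d) R.

(* The distribution N(0, v) on the line, v being the variance; normal_prob is
   not the Dirac mass when the standard deviation is 0. *)
Definition normal1 (v : R) : set R -> \bar R :=
  if v == 0 then \d_(0 : R) else normal_prob 0 (Num.sqrt v).

(* P is N(0, S): every linear functional u^T g of g ~ P has law
   N(0, u^T S u). The matrix S may be singular, so P need not have a density. *)
Definition gaussian (S : 'M[R]_d) P : Prop :=
  forall (u : 'cV[R]_d) (A : set R), measurable A ->
    P [set g : 'cV[R]_d | A (dot u g)] = normal1 (dot u (S *m u)) A.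

Definition mixture (p : R) (P1 P2 Q : probability (borel_cV R d) R) : Prop :=
  forall A : set (borel_cV R d), measurable A ->
    Q A = (p%:E * P1 A + (1 - p)%:E * P2 A)%E.

Definition mx_expectation m n P (X : 'cV[R]_d -> 'M[R]_(m, n)) : 'M[R]_(m, n) :=
  \matrix_(i, j) fine 'E_P[fun g : borel_cV R d => X g i j].

End Gaussian.

Section Estimators.
Context {R : realType} {d : nat}.

Definition grad_base (F : 'cV[R]_d -> R) (sigma : R) (theta g : 'cV[R]_d) :
    'cV[R]_d :=
  ((F (theta + sigma *: g) - F (theta - sigma *: g)) / (2 * sigma)) *: g.

Definition grad_asebo (C1 : 'M[R]_d) (F : 'cV[R]_d -> R) (sigma : R)
    (theta g : 'cV[R]_d) : 'cV[R]_d :=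
  invmx C1 *m
    (((F (theta + sigma *: g) - F (theta - sigma *: g)) / (2 * sigma)) *: g).

End Estimators.

(* Main.v *)
Require Import Defs.
From mathcomp Require Import all_boot all_order all_algebra.
From mathcomp Require Import all_classical all_reals all_analysis.
From mathcomp Require Import measurable_realfun normal_distribution.
From mathcomp Require Import ring lra.

Set Implicit Arguments.
Unset Strict Implicit.
Unset Printing Implicit Defensive.
Import Order.TTheory GRing.Theory Num.Theory.
Import numFieldNormedType.Exports.
Local Open Scope classical_set_scope.
Local Open Scope ring_scope.

(** The central difference quotient of [F] along [g] kills the even part of the
    Taylor expansion: by [smooth3] applied to [g] and to [- g],
    (F (theta + sigma g) - F (theta - sigma g)) / (2 sigma) is
    [dot (gradient F theta) g] up to an error rho(g) with
    |rho(g)| <= sigma^2 tau |g|^3 / 6 ([slope_sub_gradient]).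

    Let P be a law with second moment matrix C.  Multiplying by [g] and
    integrating, the linear part contributes exactly C applied to the gradient
    ([moment_dotM]), and the error contributes at most sigma^2 tau / 6 times a
    multiple of E |g|^4 ([Rintegral_cubic_le]).  Hence the baseline estimator
    under P has mean within O(sigma^2 tau d^3) of C applied to the gradient
    ([grad_base_bias]).  For N(0, I) this is the first claim.  For the mixture,
    C = p A A^T + (1 - p) B B^T where [A, B] is an orthogonal matrix, so C is
    invertible, the ASEBO estimator is C^-1 applied to the baseline one, and its
    bias is C^-1 applied to that of the baseline; as A A^T and B B^T are
    complementary orthogonal projections, C^-1 has operator norm at most
    1 / min(p, 1 - p) ([norm2_invmx_mix]), which is the factor that the bound on
    sigma absorbs ([sigma_bound]).

    The probabilistic input is only the second moment (exactly) and the fourth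
    moment (up to a constant) of one-dimensional Gaussians, as a law
    [gaussian S] is described by its one-dimensional marginals.  Both moments
    come from the single formula
    E exp((1 - u^2) x^2 / (2 s^2)) = 1 / u under N(0, s^2), a change of standard
    deviation in the density: the second moment by comparing exp y with 1 + y
    and letting u tend to 1 from both sides ([normal_prob_moment2]), the fourth
    by comparing exp y with y^2 / 2 at u = 1/2 ([normal_prob_moment4]). *)

(** * Moments of the normal distribution on the line *)

(** The Radon-Nikodym derivative of the normal law is only determined almost
    everywhere; it agrees there with the density because both integrate to the
    law over every measurable set. *)
Lemma ge0_integral_normal_prob (R : realType) (m s : R) (f : R -> \bar R) :
  measurable_fun setT f -> (forall x, 0 <= f x)%E ->
  (\int[normal_prob m s]_x f x =
   \int[lebesgue_measure]_x (f x * (normal_pdf m s x)%:E))%E.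
Proof.
move=> mf f0; have dom := @normal_prob_dominates R m s.
rewrite -(Radon_Nikodym_SigmaFinite.change_of_variables dom)//.
apply: ae_eq_integral => //.
- apply: emeasurable_funM => //.
  exact: (measurable_int _ (Radon_Nikodym_SigmaFinite.f_integrable dom)).
- apply: emeasurable_funM => //; apply/measurable_EFinP.
  exact: measurable_normal_pdf.
- apply: ae_eqe_mul2l; apply: integral_ae_eq => //=.
  + exact: Radon_Nikodym_SigmaFinite.f_integrable.
  + by apply/measurable_EFinP; exact: measurable_normal_pdf.
  + by move=> E _ mE; rewrite -Radon_Nikodym_SigmaFinite.f_integral.
Qed.

(** The exponential tilts the density of N(0, s^2) into that of N(0, (s/u)^2),
    up to the ratio of the normalizing constants, which is 1/u.  Positive values
    of 1 - u^2 make this an exponential moment, negative ones a damping. *)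
Lemma integral_expR_sqr_normal_prob (R : realType) (s u : R) :
  0 < s -> 0 < u ->
  (\int[normal_prob 0 s]_x
     (expR ((1 - u ^+ 2) * (x ^+ 2 / (s ^+ 2 *+ 2))))%:E = u^-1%:E)%E.
Proof.
move=> s0 u0.
have su0 : 0 < s / u by rewrite divr_gt0.
rewrite ge0_integral_normal_prob; last first.
- by move=> x; rewrite lee_fin expR_ge0.
- apply/measurable_EFinP; apply: measurableT_comp => //.
  by apply: measurable_funM => //; apply: measurable_funM.
transitivity (\int[lebesgue_measure]_x (u^-1%:E * (normal_pdf 0 (s / u) x)%:E))%E.
  apply: eq_integral => x _; rewrite -!EFinM; congr EFin.
  rewrite !normal_pdfE ?gt_eqF//.
  have -> : normal_peak (s / u) = u * normal_peak s.
    rewrite /normal_peak -[in RHS](invrK u) -invfM; congr (_^-1).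
    rewrite -[X in _ = X * _](@ger0_norm _ u^-1) ?invr_ge0 ?ltW//.
    rewrite -sqrtr_sqr -sqrtrM ?sqr_ge0//; congr Num.sqrt.
    by rewrite expr_div_n exprVn; ring.
  rewrite -[u * _ * _]mulrA mulKf ?gt_eqF// mulrCA; congr (_ * _).
  rewrite /normal_fun -expRD; congr expR; rewrite subr0.
  by field; rewrite ?gt_eqF.
rewrite integralZl//; last exact: integrable_normal_pdf.
by rewrite integral_normal_pdf mule1.
Qed.

(** With y = x^2 / (2 s^2), integrating 1 + (1 - u^2) y <= exp((1 - u^2) y) gives
    1 + (1 - u^2) E y <= 1/u for every u > 0.  Dividing by 1 - u, which is
    positive for u < 1 and negative for u > 1, this squeezes E y between
    1 / (u (1 + u)) for u > 1 and for u < 1, and both tend to 1/2 as u tends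
    to 1. *)
Lemma normal_prob_moment2 (R : realType) (s : R) : 0 < s ->
  (\int[normal_prob 0 s]_x (x ^+ 2)%:E = (s ^+ 2)%:E)%E.
Proof.
move=> s0.
have s2 : 0 < s ^+ 2 *+ 2 by rewrite mulrn_wgt0// exprn_gt0.
pose y (x : R) := x ^+ 2 / (s ^+ 2 *+ 2).
have y0 x : 0 <= y x by rewrite /y divr_ge0 ?sqr_ge0// ltW.
have my : measurable_fun setT y by apply: measurable_funM.
have mexp (u : R) : measurable_fun setT (fun x => expR ((1 - u ^+ 2) * y x)).
  by apply: measurableT_comp => //; apply: measurable_funM.
pose I := (\int[normal_prob 0 s]_x (y x)%:E)%E.
have I0 : (0 <= I)%E by apply: integral_ge0 => x _; rewrite lee_fin.
have IZ (c : R) : 0 <= c ->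
    (\int[normal_prob 0 s]_x (c * y x)%:E = c%:E * I)%E.
  move=> c0; under eq_integral do rewrite EFinM.
  rewrite ge0_integralZl//.
  - by apply/measurable_EFinP.
  - by move=> x _; rewrite lee_fin.
(* For u < 1 all terms are nonnegative, which also yields that I is finite. *)
have upper (u : R) : 0 < u -> u < 1 -> (1 + (1 - u ^+ 2)%:E * I <= u^-1%:E)%E.
  move=> u0 u1; rewrite -(integral_expR_sqr_normal_prob s0 u0).
  have c0 : 0 <= 1 - u ^+ 2 by rewrite subr_ge0 expr_le1// ltW.
  rewrite -IZ// -(@probability_setT _ _ _ (normal_prob 0 s)) -[X in (X + _)%E]mul1e.
  rewrite -integral_cst// -ge0_integralD//.
  - apply: ge0_le_integral => //.
    + by move=> x _; rewrite adde_ge0// lee_fin mulr_ge0.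
    + apply: emeasurable_funD => //; apply/measurable_EFinP.
      by apply: measurable_funM.
    + by apply/measurable_EFinP; exact: mexp.
    + by move=> x _; rewrite -EFinD lee_fin expR_ge1Dx.
  - by move=> x _; rewrite lee_fin mulr_ge0.
  - by apply/measurable_EFinP; apply: measurable_funM.
(* For u > 1 the negative term is moved to the other side, so that only
   integrals of nonnegative functions occur. *)
have lower (u : R) : 1 < u -> (1 <= u^-1%:E + (u ^+ 2 - 1)%:E * I)%E.
  move=> u1; have u0 : 0 < u by apply: lt_trans u1.
  rewrite -(integral_expR_sqr_normal_prob s0 u0).
  have c0 : 0 <= u ^+ 2 - 1 by rewrite subr_ge0 expr_ge1// ltW.
  rewrite -IZ// -(@probability_setT _ _ _ (normal_prob 0 s)) -[X in (X <= _)%E]mul1e.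
  rewrite -integral_cst// -ge0_integralD//.
  - apply: ge0_le_integral => //.
    + apply: emeasurable_funD => //; apply/measurable_EFinP; first exact: mexp.
      by apply: measurable_funM.
    + move=> x _; rewrite -EFinD lee_fin.
      by have := expR_ge1Dx ((1 - u ^+ 2) * y x); lra.
  - by apply/measurable_EFinP; exact: mexp.
  - by move=> x _; rewrite lee_fin mulr_ge0.
  - by apply/measurable_EFinP; apply: measurable_funM.
clearbody I; case: I I0 IZ upper lower => [m| |] // I0 IZ upper lower; last first.
  have := upper 2^-1 ltac:(lra) ltac:(lra).
  by rewrite mulry gtr0_sg ?mul1e//; lra.
have m_ge0 : 0 <= m by rewrite -lee_fin.
have upper' (u : R) : 0 < u -> u < 1 -> u * (1 + u) * m <= 1.
  move=> u0 u1; have := upper u u0 u1.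
  rewrite -EFinM -EFinD lee_fin -(ler_pM2l u0) divff ?gt_eqF// => h.
  by rewrite -(@ler_pM2l _ (1 - u)) ?subr_gt0//; lra.
have lower' (u : R) : 1 < u -> 1 <= u * (1 + u) * m.
  move=> u1; have u0 : 0 < u by apply: lt_trans u1.
  have := lower u u1.
  rewrite -EFinM -EFinD lee_fin -(ler_pM2l u0) mulrDr divff ?gt_eqF// => h.
  by rewrite -(@ler_pM2l _ (u - 1)) ?subr_gt0//; lra.
(* If m differed from 1/2, the bounds at u = 1 - t or u = 1 + t would fail for t
   proportional to the gap. *)
have mE : m = 2^-1.
  apply/eqP; rewrite eq_le !leNgt; apply/andP; split; apply/negP => hm.
  - pose t := (2 * m - 1) / (6 * m).
    have tE : 6 * (t * m) = 2 * m - 1 by rewrite /t; field; lra.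
    have t0 : 0 < t by rewrite /t divr_gt0; lra.
    have t1 : t < 1 by rewrite /t ltr_pdivrMr; lra.
    have := upper' (1 - t) ltac:(lra) ltac:(lra).
    have : 0 <= t ^+ 2 * m by rewrite mulr_ge0 ?sqr_ge0.
    lra.
  - pose t := (1 - 2 * m) / 4.
    have tE : 4 * t = 1 - 2 * m by rewrite /t; field.
    have t0 : 0 < t by lra.
    have t1 : t <= 1 by lra.
    have tm0 : 0 <= t * m by rewrite mulr_ge0// ltW.
    have tm : t * m <= t / 2 by rewrite ler_pM2l//; lra.
    have ttm : t * (t * m) <= t * m by rewrite ler_piMl.
    have := lower' (1 + t) ltac:(lra).
    lra.
transitivity (\int[normal_prob 0 s]_x ((s ^+ 2 *+ 2) * y x)%:E)%E.
  apply: eq_integral => x _; congr EFin; rewrite /y; field.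
  by rewrite gt_eqF.
by rewrite IZ ?ltW// mE -EFinM; congr EFin; field.
Qed.

(** The exact value is 3 s^4; a constant multiple of s^4 is enough here and
    follows from z^2 <= 15 exp (3 z / 8) for z = x^2 / s^2, where the exponential
    has expectation 2. *)
Lemma normal_prob_moment4 (R : realType) (s : R) : 0 < s ->
  (\int[normal_prob 0 s]_x (x ^+ 4)%:E <= (30 * s ^+ 4)%:E)%E.
Proof.
move=> s0.
pose u : R := 2^-1.
pose f (x : R) := expR ((1 - u ^+ 2) * (x ^+ 2 / (s ^+ 2 *+ 2))).
have mf : measurable_fun setT f.
  by apply: measurableT_comp => //; apply: measurable_funM => //; apply: measurable_funM.
have c0 : 0 <= 15 * s ^+ 4 by rewrite mulr_ge0// exprn_ge0// ltW.
apply: (@le_trans _ _ (\int[normal_prob 0 s]_x ((15 * s ^+ 4)%:E * (f x)%:E))%E).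
  apply: ge0_le_integral => //.
  - by move=> x _; rewrite lee_fin exprn_even_ge0.
  - by apply/measurable_EFinP; apply: measurable_funX.
  - by apply/measurable_EFinP; apply: measurable_funM.
  - move=> x _; rewrite -EFinM lee_fin.
    pose z := x ^+ 2 / s ^+ 2.
    have z0 : 0 <= z by rewrite /z divr_ge0 ?sqr_ge0.
    have -> : x ^+ 4 = s ^+ 4 * z ^+ 2 by rewrite /z; field; rewrite gt_eqF.
    have -> : f x = expR (3 / 8 * z).
      by congr expR; rewrite /u /z; field; rewrite gt_eqF.
    rewrite (_ : 15 * _ * _ = s ^+ 4 * (15 * expR (3 / 8 * z))); last by ring.
    rewrite ler_pM2l ?exprn_gt0//.
    have /(expR_ge1Dxn 1) : 0 <= 3 / 8 * z by lra.
    by rewrite (_ : 2`!%:R = 2 :> R)//; have := sqr_ge0 z; lra.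
rewrite ge0_integralZl//; last 2 first.
- exact/measurable_EFinP.
- by move=> x _; rewrite lee_fin expR_ge0.
rewrite integral_expR_sqr_normal_prob//; last by rewrite /u; lra.
rewrite -EFinM lee_fin /u; lra.
Qed.

(** * The Euclidean norm on column vectors *)

(** The sum of the squares (n a_i - S)^2, where S is the sum of the a_i, is n
    times the difference of the two sides. *)
Lemma sqr_sum_le (R : realFieldType) n (a : 'I_n -> R) :
  (\sum_i a i) ^+ 2 <= n%:R * \sum_i a i ^+ 2.
Proof.
case: n a => [|n] a; first by rewrite !big_ord0 mulr0 expr0n.
set S := \sum_i a i; set Q := \sum_i a i ^+ 2; set N : R := n.+1%:R.
have N0 : 0 < N by rewrite ltr0n.
have : 0 <= \sum_i (N * a i - S) ^+ 2.
  by apply: sumr_ge0 => i _; exact: sqr_ge0.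
have -> : \sum_i (N * a i - S) ^+ 2 = N * (N * Q - S ^+ 2).
  under eq_bigr do rewrite sqrrB exprMn.
  rewrite !big_split/= -mulr_sumr sumr_const card_ord sumrN.
  under [X in _ - X + _]eq_bigr do rewrite -mulr_natl -mulrA mulrA.
  rewrite -mulr_sumr -mulr_suml -/S -/Q -[_ *+ n.+1]mulr_natl -/N; ring.
by rewrite pmulr_rge0// subr_ge0.
Qed.

Section Dot.
Context {R : realType} {d : nat}.
Implicit Types u v w : 'cV[R]_d.

Lemma dotE u v : dot u v = \sum_i u i ord0 * v i ord0.
Proof. by rewrite /dot mxE; apply: eq_bigr => i _; rewrite mxE. Qed.

Lemma dotC u v : dot u v = dot v u.
Proof. by rewrite !dotE; apply: eq_bigr => i _; rewrite mulrC. Qed.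

Lemma dotDl u v w : dot (u + v) w = dot u w + dot v w.
Proof. by rewrite /dot linearD mulmxDl mxE. Qed.

Lemma dotBl u v w : dot (u - v) w = dot u w - dot v w.
Proof. by rewrite /dot linearB mulmxBl !mxE. Qed.

Lemma dotDr u v w : dot u (v + w) = dot u v + dot u w.
Proof. by rewrite /dot mulmxDr mxE. Qed.

Lemma dotBr u v w : dot u (v - w) = dot u v - dot u w.
Proof. by rewrite /dot mulmxBr !mxE. Qed.

Lemma dotZl a u v : dot (a *: u) v = a * dot u v.
Proof. by rewrite /dot linearZ -scalemxAl mxE. Qed.

Lemma dotZr a u v : dot u (a *: v) = a * dot u v.
Proof. by rewrite dotC dotZl dotC. Qed.

Lemma dotNr u v : dot u (- v) = - dot u v.
Proof. by rewrite /dot mulmxN mxE. Qed.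

Lemma dot_delta i v : dot (delta_mx i ord0) v = v i ord0.
Proof.
rewrite dotE (bigD1 i)//= mxE !eqxx mul1r big1 ?addr0// => j ji.
by rewrite mxE (negbTE ji) mul0r.
Qed.

Lemma dot_ge0 v : 0 <= dot v v.
Proof. by rewrite dotE sumr_ge0// => i _; rewrite -expr2 sqr_ge0. Qed.

Lemma norm2_ge0 v : 0 <= norm2 v.
Proof. exact: sqrtr_ge0. Qed.

Lemma sqr_norm2 v : norm2 v ^+ 2 = dot v v.
Proof. by rewrite sqr_sqrtr// dot_ge0. Qed.

Lemma norm2N v : norm2 (- v) = norm2 v.
Proof. by rewrite /norm2 dotNr dotC dotNr opprK. Qed.

Lemma ler_norm2 (B : R) v : 0 <= B -> dot v v <= B ^+ 2 -> norm2 v <= B.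
Proof.
by move=> B0 h; rewrite -(ger0_norm B0) -sqrtr_sqr /norm2 ler_wsqrtr.
Qed.

Lemma coord_le_norm2 v i : `|v i ord0| <= norm2 v.
Proof.
rewrite -sqrtr_sqr ler_wsqrtr// dotE (bigD1 i)//= expr2 lerDl.
by rewrite sumr_ge0// => j _; rewrite -expr2 sqr_ge0.
Qed.

Lemma norm2_le_coord (B : R) v :
  (forall i, `|v i ord0| <= B) -> 0 <= B -> norm2 v <= d%:R * B.
Proof.
move=> vB B0; apply: ler_norm2; first by rewrite mulr_ge0.
rewrite exprMn dotE; apply: (@le_trans _ _ (\sum_(i < d) B ^+ 2)).
  by apply: ler_sum => i _; rewrite -expr2 -real_normK ?num_real// lerXn2r ?nnegrE.
rewrite sumr_const card_ord -[leLHS]mulr_natl ler_wpM2r ?sqr_ge0//.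
by rewrite -natrX ler_nat; case: (d) => // n; rewrite -mulnn leq_pmulr.
Qed.

Lemma norm2X4_le v : norm2 v ^+ 4 <= d%:R * \sum_i (v i ord0) ^+ 4.
Proof.
rewrite (exprM _ 2 2) sqr_norm2 dotE.
under [X in _ <= _ * X]eq_bigr do rewrite (exprM _ 2 2).
exact: sqr_sum_le.
Qed.

End Dot.

(** * Measurability for the Borel sigma-algebra of the space of vectors *)

Section Borel.
Context {R : realType} {d : nat}.
Local Notation T := (borel_cV R d).

Lemma continuous_measurable_borel_cV (f : 'cV[R]_d -> R) :
  continuous f -> measurable_fun [set: T] (f : T -> R).
Proof.
move=> cf; apply: (measurability _ (RGenOpens.measurableE R)).
move=> _ [_ [a [b ->] <-]]; rewrite setTI.
by apply: sub_sigma_algebra; apply: open_comp.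
Qed.

Lemma measurable_coord i : measurable_fun [set: T] (fun g : T => g i ord0).
Proof. by apply: continuous_measurable_borel_cV; exact: coord_continuous. Qed.

Lemma measurable_dot (u : 'cV[R]_d) : measurable_fun [set: T] (dot u : T -> R).
Proof.
rewrite (_ : dot u = fun v => \sum_i u i ord0 * v i ord0); last first.
  by apply/funext => v; rewrite dotE.
by apply: measurable_sum => i; apply: measurable_funM; last exact: measurable_coord.
Qed.

End Borel.

(** * Moments of Gaussian vectors and of their mixtures *)

Section GaussianMoments.
Context {R : realType} {d : nat}.
Local Notation T := (borel_cV R d).
Implicit Types (P : probability T R) (S C : 'M[R]_d).

(** The law of a linear functional is a Dirac mass at 0 when its variance
    vanishes, whence the two cases. *)
Lemma ge0_integral_gaussian S P (u : 'cV[R]_d) (f : R -> \bar R) :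
  gaussian S P -> measurable_fun setT f -> (forall x, 0 <= f x)%E ->
  0 <= dot u (S *m u) ->
  (\int[P]_g f (dot u g) =
   if (dot u (S *m u) == 0)%R then f 0%R else
   \int[normal_prob 0 (Num.sqrt (dot u (S *m u)))]_x f x)%E.
Proof.
move=> hP mf f0 v0.
have mdot := measurable_dot u.
rewrite -(@ge0_integral_pushforward _ _ T (measurableTypeR R) R (dot u) mdot P
  setT f measurableT mf)//.
have law A : measurable A -> pushforward P (dot u) A = normal1 (dot u (S *m u)) A.
  exact: hP.
case: ifPn => [v_eq0|v_neq0].
- rewrite (eq_measure_integral (\d_(0 : measurableTypeR R))); last first.
    by move=> A mA _; rewrite [LHS]law// /normal1 v_eq0.
  by rewrite integral_dirac// diracT mul1e.
- rewrite (eq_measure_integral (normal_prob 0 (Num.sqrt (dot u (S *m u)))))//.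
  by move=> A mA _; rewrite [LHS]law// /normal1 (negbTE v_neq0).
Qed.

Lemma gaussian_moment2 S P (u : 'cV[R]_d) : gaussian S P ->
  0 <= dot u (S *m u) ->
  (\int[P]_g (dot u g ^+ 2)%:E = (dot u (S *m u))%:E)%E.
Proof.
move=> hP v0.
have mf : measurable_fun setT (fun x : R => (x ^+ 2)%:E).
  by apply/measurable_EFinP; apply: measurable_funX.
rewrite (ge0_integral_gaussian hP mf)//; last first.
  by move=> x; rewrite lee_fin sqr_ge0.
case: ifPn => [/eqP ->|vn0]; first by rewrite expr0n.
by rewrite normal_prob_moment2 ?sqr_sqrtr// sqrtr_gt0 lt0r vn0.
Qed.

Lemma gaussian_moment4 S P (u : 'cV[R]_d) : gaussian S P ->
  0 <= dot u (S *m u) ->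
  (\int[P]_g (dot u g ^+ 4)%:E <= (30 * dot u (S *m u) ^+ 2)%:E)%E.
Proof.
move=> hP v0.
have mf : measurable_fun setT (fun x : R => (x ^+ 4)%:E).
  by apply/measurable_EFinP; apply: measurable_funX.
rewrite (ge0_integral_gaussian hP mf)//; last first.
  by move=> x; rewrite lee_fin exprn_even_ge0.
case: ifPn => [/eqP ->|vn0].
  by rewrite expr0n lee_fin mulr_ge0 ?sqr_ge0.
apply: le_trans (normal_prob_moment4 _) _; first by rewrite sqrtr_gt0 lt0r vn0.
by rewrite (exprM _ 2 2) sqr_sqrtr.
Qed.

Lemma ge0_integral_mixture (p : R) P1 P2 Q (f : T -> \bar R) :
  mixture p P1 P2 Q -> 0 <= p <= 1 ->
  measurable_fun setT f -> (forall x, 0 <= f x)%E ->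
  (\int[Q]_x f x = p%:E * \int[P1]_x f x + (1 - p)%:E * \int[P2]_x f x)%E.
Proof.
move=> hQ /andP[p0 p1] mf f0.
have q0 : 0 <= 1 - p by rewrite subr_ge0.
transitivity (\int[measure_add (mscale (NngNum p0) P1) (mscale (NngNum q0) P2)]_x f x)%E.
  by apply: eq_measure_integral => A mA _; rewrite [LHS]hQ// [RHS]measure_addE.
by rewrite ge0_integral_measure_add// !ge0_integral_mscale.
Qed.

(** What the bias estimate needs to know of a law.  Unlike Gaussianity, this
    property passes to mixtures. *)
Definition moments C (K : R) P : Prop :=
  (forall u, \int[P]_g (dot u g ^+ 2)%:E = (dot u (C *m u))%:E)%E /\
  (forall i, \int[P]_g (g i ord0 ^+ 4)%:E <= K%:E)%E.

Lemma measurable_dotX (u : 'cV[R]_d) n :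
  measurable_fun [set: T] (fun g : T => (dot u g ^+ n)%:E).
Proof. by apply/measurable_EFinP; apply: measurable_funX; exact: measurable_dot. Qed.

Lemma gaussian_moments S P : gaussian S P ->
  (forall u, 0 <= dot u (S *m u)) -> (forall i, S i i <= 1) ->
  moments S 30 P.
Proof.
move=> hP S0 S1; split=> [u|i]; first exact: gaussian_moment2.
under eq_integral do rewrite -dot_delta.
apply: le_trans (gaussian_moment4 hP (S0 _)) _; rewrite lee_fin.
have := S0 (delta_mx i ord0).
have -> : dot (delta_mx i ord0) (S *m delta_mx i ord0) = S i i.
  by rewrite dot_delta -colE mxE.
by move=> Sii0; rewrite ler_piMr// expr_le1.
Qed.

Lemma mixture_moments (p K : R) C1 C2 P1 P2 Q :
  mixture p P1 P2 Q -> 0 <= p <= 1 ->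
  moments C1 K P1 -> moments C2 K P2 ->
  moments (p *: C1 + (1 - p) *: C2) K Q.
Proof.
move=> hQ p01 [m1 k1] [m2 k2]; split=> [u|i].
  rewrite (ge0_integral_mixture hQ)//; last 2 first.
  - exact: measurable_dotX.
  - by move=> x; rewrite lee_fin sqr_ge0.
  by rewrite m1 m2 -!EFinM -EFinD mulmxDl dotDr -!scalemxAl !dotZr.
rewrite (ge0_integral_mixture hQ)//; last 2 first.
- by under eq_fun do rewrite -dot_delta; exact: measurable_dotX.
- by move=> x; rewrite lee_fin exprn_even_ge0.
have /andP[p0 p1] := p01.
have -> : K%:E = (p%:E * K%:E + (1 - p)%:E * K%:E)%E.
  by rewrite -!EFinM -EFinD; congr EFin; ring.
by rewrite leeD// lee_wpmul2l// lee_fin subr_ge0.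
Qed.

End GaussianMoments.

(** * Mixed second moments and cubic errors *)

Lemma Rintegral_sum_ord dsp (T : measurableType dsp) (R : realType)
    (mu : {measure set T -> \bar R}) n (f : 'I_n -> T -> R) :
  (forall i, mu.-integrable setT (EFin \o f i)) ->
  \int[mu]_x (\sum_i f i x) = \sum_i \int[mu]_x f i x.
Proof.
move=> fi; rewrite /Rintegral; under eq_integral do rewrite -sumEFin.
rewrite (integral_sum measurableT fi) -sum_fine// => i _.
exact: integrable_fin_num.
Qed.

Section MomentEstimates.
Context {R : realType} {d : nat}.
Local Notation T := (borel_cV R d).
Variables (P : probability T R) (C : 'M[R]_d) (K : R).
Hypothesis PCK : moments C K P.

Lemma integrable_sqr_dot (u : 'cV[R]_d) :
  P.-integrable setT (EFin \o (fun g : T => dot u g ^+ 2)).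
Proof.
apply/integrableP; split; first exact: measurable_dotX.
under eq_integral do rewrite /= ger0_norm ?sqr_ge0//.
by rewrite PCK.1 ltry.
Qed.

Lemma integrable_dotM (u w : 'cV[R]_d) :
  P.-integrable setT (EFin \o (fun g : T => dot u g * dot w g)).
Proof.
apply: (@le_integrable _ _ _ _ _ measurableT _
  (EFin \o (fun g : T => dot u g ^+ 2 + dot w g ^+ 2))).
- by apply/measurable_EFinP; apply: measurable_funM; exact: measurable_dot.
- move=> g _ /=; rewrite lee_fin normrM.
  rewrite [leRHS]ger0_norm ?addr_ge0 ?sqr_ge0//.
  rewrite -(real_normK (num_real (dot u g))) -(real_normK (num_real (dot w g))).
  have := sqr_ge0 (`|dot u g| - `|dot w g|).
  have := normr_ge0 (dot u g); have := normr_ge0 (dot w g); nra.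
- exact: (integrableD measurableT (integrable_sqr_dot u) (integrable_sqr_dot w)).
Qed.

(** Polarization: 4 (u.g) (w.g) = ((u + w).g)^2 - ((u - w).g)^2. *)
Lemma moment_dotM (u w : 'cV[R]_d) : C^T = C ->
  \int[P]_g (dot u g * dot w g) = dot u (C *m w).
Proof.
move=> Csym.
have E v : \int[P]_g (dot v g ^+ 2) = dot v (C *m v) by rewrite /Rintegral PCK.1.
have -> : (fun g : T => dot u g * dot w g) =
    (fun g : T => 4^-1 * (dot (u + w) g ^+ 2 - dot (u - w) g ^+ 2)).
  by apply/funext => g; rewrite dotDl dotBl; field.
rewrite RintegralZl//; last first.
  exact: (integrableB measurableT (integrable_sqr_dot _) (integrable_sqr_dot _)).
rewrite RintegralB//; try exact: integrable_sqr_dot.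
rewrite !E mulmxDr mulmxBr !dotBl !dotDl !dotBr !dotDr.
have -> : dot w (C *m u) = dot u (C *m w).
  by rewrite dotC /dot trmx_mul Csym mulmxA.
by field.
Qed.

Lemma integrable_coord4 i :
  P.-integrable setT (EFin \o (fun g : T => g i ord0 ^+ 4)).
Proof.
apply/integrableP; split.
  by apply/measurable_EFinP; apply: measurable_funX; exact: measurable_coord.
under eq_integral do rewrite /= ger0_norm ?exprn_even_ge0//.
by rewrite (le_lt_trans (PCK.2 i))// ltry.
Qed.

Lemma integrable_sum_coord4 (c : R) :
  P.-integrable setT (EFin \o (fun g : T => c * \sum_i g i ord0 ^+ 4)).
Proof.
have h := integrable_sum measurableT (index_enum 'I_d)
  (fun i (_ : xpredT i) => integrable_coord4 i).
have := integrableZl measurableT c h.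
by apply: eq_integrable => // g _; rewrite /= sumEFin -EFinM.
Qed.

Lemma Rintegral_coord4_le i : \int[P]_g (g i ord0 ^+ 4) <= K.
Proof.
rewrite -lee_fin /Rintegral fineK; first exact: PCK.2.
by apply: integrable_fin_num => //; exact: integrable_coord4.
Qed.

Lemma Rintegral_sum_coord4_le (c : R) : 0 <= c ->
  \int[P]_g (c * \sum_i g i ord0 ^+ 4) <= c * (d%:R * K).
Proof.
move=> c0; rewrite RintegralZl//; last first.
  by have := integrable_sum_coord4 1; under eq_fun do rewrite mul1r.
rewrite ler_wpM2l//.
have -> : \int[P]_g (\sum_i g i ord0 ^+ 4) = \sum_i \int[P]_g (g i ord0 ^+ 4).
  exact: Rintegral_sum_ord integrable_coord4.
apply: (@le_trans _ _ (\sum_(i < d) K)).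
  by apply: ler_sum => i _; exact: Rintegral_coord4_le.
by rewrite sumr_const card_ord mulr_natl.
Qed.

(** A function [rho] of cubic growth stands for the Taylor remainder.  Times a
    coordinate it is bounded by a multiple of |g|^4, hence, by Cauchy-Schwarz
    over the coordinates, of the sum of their fourth powers. *)
Section Cubic.
Variables (rho : T -> R) (B : R).
Hypotheses (mrho : measurable_fun setT rho) (B0 : 0 <= B).
Hypothesis rhoB : forall g, `|rho g| <= B * norm2 g ^+ 3.

Let dominate g i : `|rho g * g i ord0| <= (B * d%:R) * \sum_i g i ord0 ^+ 4.
Proof.
rewrite normrM -mulrA; apply: (@le_trans _ _ (B * norm2 g ^+ 4)); last first.
  by rewrite ler_wpM2l// norm2X4_le.
rewrite [_ ^+ 4]exprSr mulrA.
by apply: ler_pM => //; exact: coord_le_norm2.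
Qed.

Lemma integrable_cubic i :
  P.-integrable setT (EFin \o (fun g : T => rho g * g i ord0)).
Proof.
apply: (@le_integrable _ _ _ _ _ measurableT _
  (EFin \o (fun g : T => (B * d%:R) * \sum_i g i ord0 ^+ 4))).
- by apply/measurable_EFinP; apply: measurable_funM => //; exact: measurable_coord.
- by move=> g _ /=; rewrite lee_fin (le_trans (dominate g i))// ler_norm.
- exact: integrable_sum_coord4.
Qed.

Lemma Rintegral_cubic_le i :
  `|\int[P]_g (rho g * g i ord0)| <= B * d%:R ^+ 2 * K.
Proof.
have intr := integrable_cubic i.
apply: le_trans (le_normr_Rintegral measurableT intr) _.
apply: (@le_trans _ _ (\int[P]_g ((B * d%:R) * \sum_i g i ord0 ^+ 4))).
  apply: le_Rintegral => //.
  - exact: integrable_norm intr.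
  - exact: integrable_sum_coord4.
apply: le_trans (Rintegral_sum_coord4_le _) _; first by rewrite mulr_ge0.
by rewrite expr2 !mulrA.
Qed.

End Cubic.
End MomentEstimates.

(** * Expectations of random matrices *)

Section MatrixExpectation.
Context {R : realType} {d : nat}.
Local Notation T := (borel_cV R d).
Variable P : probability T R.

Lemma mx_expectationE m n (X : 'cV[R]_d -> 'M[R]_(m, n)) i j :
  mx_expectation P X i j = \int[P]_g X g i j.
Proof. by rewrite mxE unlock. Qed.

Lemma mx_expectation_mulmxl m n k (A : 'M[R]_(k, m))
    (X : 'cV[R]_d -> 'M[R]_(m, n)) :
  (forall i j, P.-integrable setT (EFin \o (fun g : T => X g i j))) ->
  mx_expectation P (fun g => A *m X g) = A *m mx_expectation P X.
Proof.
move=> intX; apply/matrixP => i j; rewrite mx_expectationE mxE.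
under eq_Rintegral do rewrite mxE.
rewrite Rintegral_sum_ord; last first.
  move=> l; have := integrableZl measurableT (A i l) (intX l j).
  by apply: eq_integrable.
by apply: eq_bigr => l _; rewrite RintegralZl// mx_expectationE.
Qed.

Lemma mx_expectation_outer C K : moments C K P -> C^T = C ->
  mx_expectation P (fun g => g *m g^T) = C.
Proof.
move=> PCK Csym; apply/matrixP => i j; rewrite mx_expectationE.
have -> : (fun g : T => (g *m g^T) i j) =
    (fun g : T => dot (delta_mx i ord0) g * dot (delta_mx j ord0) g).
  by apply/funext => g; rewrite !dot_delta mxE big_ord1 mxE.
by rewrite (moment_dotM PCK)// dot_delta -colE mxE.
Qed.

End MatrixExpectation.

(** * Bias of the baseline estimator *)

Section Bias.
Context {R : realType} {d : nat}.
Local Notation T := (borel_cV R d).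
Variables (F : 'cV[R]_d -> R) (tau sigma : R).
Hypotheses (sigma0 : 0 < sigma) (tau0 : 0 <= tau) (Fsmooth : smooth3 tau sigma F).

Let slope theta (g : 'cV[R]_d) : R :=
  (F (theta + sigma *: g) - F (theta - sigma *: g)) / (2 * sigma).

(** The expansions at [g] and [- g] share their constant and Hessian terms, which
    cancel; the two third order terms have possibly different intermediate
    vectors and are bounded separately. *)
Lemma slope_sub_gradient theta (g : 'cV[R]_d) :
  `|slope theta g - dot (gradient F theta) g|
    <= sigma ^+ 2 * tau / 6 * norm2 g ^+ 3.
Proof.
have [_ /(_ theta) expand] := Fsmooth.
have [v [Fv [_ [v3 vg]]]] := expand g.
have [w [Fw [_ [w3 wg]]]] := expand (- g).
rewrite norm2N in wg.
set a := third_derivative F theta v v v in Fv v3.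
set b := third_derivative F theta w w w in Fw w3.
have Hg : dot (- g) (hessian F theta *m - g) = dot g (hessian F theta *m g).
  by rewrite mulmxN dotNr dotC dotNr opprK dotC.
rewrite Hg dotNr in Fw.
have -> : slope theta g - dot (gradient F theta) g = sigma ^+ 2 / 12 * (a - b).
  by rewrite /slope -scalerN Fv Fw; field; rewrite gt_eqF.
rewrite normrM (ger0_norm (_ : 0 <= sigma ^+ 2 / 12)); last first.
  by rewrite divr_ge0// sqr_ge0.
rewrite (_ : _ * tau / 6 * _ = sigma ^+ 2 / 12 * (2 * (tau * norm2 g ^+ 3)));
  last by field.
rewrite ler_wpM2l ?divr_ge0 ?sqr_ge0//.
by rewrite (le_trans (ler_normB _ _))//; lra.
Qed.

Lemma continuous_smooth3 : continuous F.
Proof.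
by have [[dF _] _] := Fsmooth => x; exact/differentiable_continuous/dF.
Qed.

Lemma measurable_slope theta : measurable_fun [set: T] (slope theta : T -> R).
Proof.
have mF c : measurable_fun [set: T] (fun g : T => F (theta + c *: g)).
  apply: continuous_measurable_borel_cV.
  move=> g; apply: (@continuous_comp _ _ _
    (fun h : 'cV[R]_d => theta + c *: h : 'cV[R]_d)).
    exact: continuousD (@cst_continuous _ _ theta g) (@scaler_continuous _ _ c g).
  exact: continuous_smooth3.
apply: measurable_funM => //; apply: measurable_funB; first exact: mF.
by under eq_fun do rewrite -scaleNr; exact: mF.
Qed.

Variables (P : probability T R) (C : 'M[R]_d) (K : R).
Hypotheses (PCK : moments C K P) (Csym : C^T = C) (K0 : 0 <= K).

Let rho theta (g : T) : R := slope theta g - dot (gradient F theta) g.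

Let grad_baseE theta g i : grad_base F sigma theta g i ord0 =
  dot (delta_mx i ord0) g * dot (gradient F theta) g + rho theta g * g i ord0.
Proof. by rewrite /grad_base mxE dot_delta [_ * dot _ g]mulrC -mulrDl /rho subrKC. Qed.

Let B := sigma ^+ 2 * tau / 6.
Let B0 : 0 <= B.
Proof. by rewrite /B divr_ge0// mulr_ge0 ?sqr_ge0. Qed.

Let mrho theta : measurable_fun setT (rho theta).
Proof.
by apply: measurable_funB; [exact: measurable_slope|exact: measurable_dot].
Qed.

Lemma integrable_grad_base theta i j :
  P.-integrable setT (EFin \o (fun g : T => grad_base F sigma theta g i j)).
Proof.
have := integrableD measurableT
  (integrable_dotM PCK (delta_mx i ord0) (gradient F theta))
  (integrable_cubic PCK (mrho theta) B0 (slope_sub_gradient theta) i).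
by apply: eq_integrable => // g _; rewrite /= (ord1 j) grad_baseE EFinD.
Qed.

(** Splitting the slope into its linear part and the remainder, the former
    integrates to C times the gradient.  The factor d^3 is d^2 from bounding the
    fourth moment of the norm by coordinates and d from passing from the
    coordinates of the error to its norm. *)
Lemma grad_base_bias theta :
  norm2 (mx_expectation P (grad_base F sigma theta) - C *m gradient F theta)
    <= sigma ^+ 2 * tau / 6 * d%:R ^+ 3 * K.
Proof.
apply: (@le_trans _ _ (d%:R * (B * d%:R ^+ 2 * K))); last first.
  by rewrite le_eqVlt; apply/orP; left; apply/eqP; rewrite /B; ring.
apply: norm2_le_coord => [i|]; last by rewrite mulr_ge0 ?(mulr_ge0 B0)// exprn_ge0.
rewrite mxE mx_expectationE [X in _ + X]mxE -[(C *m _) i ord0]dot_delta.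
under eq_Rintegral do rewrite grad_baseE.
rewrite RintegralD//; [|exact: integrable_dotM PCK _ _|].
  rewrite (moment_dotM PCK)// addrAC subrr add0r.
  exact: (Rintegral_cubic_le PCK (mrho theta) B0 (slope_sub_gradient theta)).
exact: (integrable_cubic PCK (mrho theta) B0 (slope_sub_gradient theta)).
Qed.

End Bias.

(** * Orthonormal frames and the covariance of the mixture *)

Lemma mulmx_tr_sym (R : comPzRingType) m n (U : 'M[R]_(m, n)) : (U *m U^T)^T = U *m U^T.
Proof. by rewrite trmx_mul trmxK. Qed.

Section Frames.
Context {R : realType} {d : nat}.

Lemma dot_mulmx_tr k (U : 'M[R]_(d, k)) (u : 'cV[R]_d) :
  dot u (U *m U^T *m u) = dot (U^T *m u) (U^T *m u).
Proof. by rewrite /dot trmx_mul trmxK !mulmxA. Qed.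

Lemma dot_colE k l (U : 'M[R]_(d, k)) (V : 'M[R]_(d, l)) i j :
  (U^T *m V) i j = dot (col i U) (col j V).
Proof. by rewrite dotE mxE; apply: eq_bigr => h _; rewrite !mxE. Qed.

Lemma orthonormal_tr_mul k (L : {vspace 'cV[R]_d}) (U : 'M[R]_(d, k)) :
  orthonormal_basis L U -> U^T *m U = 1%:M.
Proof. by move=> [_ h]; apply/matrixP => i j; rewrite dot_colE h mxE. Qed.

Lemma orthonormal_col_mem k (L : {vspace 'cV[R]_d}) (U : 'M[R]_(d, k)) j :
  orthonormal_basis L U -> col j U \in L.
Proof. by move=> [/basis_mem h _]; apply: h; apply: map_f; rewrite mem_enum. Qed.

Lemma orthogonal_tr_mul k l (L Lperp : {vspace 'cV[R]_d})
    (U : 'M[R]_(d, k)) (V : 'M[R]_(d, l)) :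
  orthocomplement L Lperp -> orthonormal_basis L U -> orthonormal_basis Lperp V ->
  U^T *m V = 0.
Proof.
move=> hperp hU hV; apply/matrixP => i j; rewrite dot_colE mxE.
apply: ((hperp (col j V)).1 (orthonormal_col_mem j hV)).
exact: orthonormal_col_mem hU.
Qed.

(** The block matrix [row_mx U V] has orthonormal columns, and it is square up to
    the equation [k + l = d]; a left inverse of a square matrix is also a right
    inverse. *)
Lemma orthonormal_resolution k l (U : 'M[R]_(d, k)) (V : 'M[R]_(d, l)) :
  (k + l)%N = d -> U^T *m U = 1%:M -> V^T *m V = 1%:M -> U^T *m V = 0 ->
  U *m U^T + V *m V^T = 1%:M.
Proof.
move=> kl UU VV UV.
have square n (M : 'M[R]_(d, n)) : n = d -> M^T *m M = 1%:M -> M *m M^T = 1%:M.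
  by move=> nd; move: M; rewrite nd => M; exact: mulmx1C.
rewrite -(square _ (row_mx U V) kl) tr_row_mx ?mul_row_col// mul_col_row UU VV UV.
by rewrite -[V^T *m U]trmxK trmx_mul trmxK UV trmx0 -scalar_mx_block.
Qed.

Section Mixture.
Variables (k l : nat) (U : 'M[R]_(d, k)) (V : 'M[R]_(d, l)) (p : R).
Hypotheses (UU : U^T *m U = 1%:M) (VV : V^T *m V = 1%:M) (UV : U^T *m V = 0).
Hypothesis resolution : U *m U^T + V *m V^T = 1%:M.
Hypothesis p01 : 0 < p < 1.

Let p0 : 0 < p. Proof. by case/andP: p01. Qed.
Let q0 : 0 < 1 - p. Proof. by case/andP: p01 => _; rewrite subr_gt0. Qed.
Let VU : V^T *m U = 0.
Proof. by rewrite -[V^T *m U]trmxK trmx_mul trmxK UV trmx0. Qed.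

Let mulmx_mix (a b a' b' : R) :
  (a *: (U *m U^T) + b *: (V *m V^T)) *m (a' *: (U *m U^T) + b' *: (V *m V^T)) =
  (a * a') *: (U *m U^T) + (b * b') *: (V *m V^T).
Proof.
rewrite mulmxDl !mulmxDr -!scalemxAl -!scalemxAr !scalerA.
have assoc m1 m2 m3 m4 m5 (A1 : 'M[R]_(m1, m2)) (A2 : 'M[R]_(m2, m3))
    (A3 : 'M[R]_(m3, m4)) (A4 : 'M[R]_(m4, m5)) :
   A1 *m A2 *m (A3 *m A4) = A1 *m (A2 *m A3) *m A4 by rewrite !mulmxA.
by rewrite !assoc UU VV UV VU !mulmx1 !mulmx0 !mul0mx !scaler0 addr0 add0r.
Qed.

Let mixK : (p *: (U *m U^T) + (1 - p) *: (V *m V^T)) *m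
  (p^-1 *: (U *m U^T) + (1 - p)^-1 *: (V *m V^T)) = 1%:M.
Proof. by rewrite mulmx_mix !divff ?gt_eqF// !scale1r. Qed.

Lemma mix_unitmx : p *: (U *m U^T) + (1 - p) *: (V *m V^T) \in unitmx.
Proof. by have [] := mulmx1_unit mixK. Qed.

Lemma invmx_mix :
  invmx (p *: (U *m U^T) + (1 - p) *: (V *m V^T)) =
  p^-1 *: (U *m U^T) + (1 - p)^-1 *: (V *m V^T).
Proof. by rewrite -[RHS](mulKmx mix_unitmx) mixK mulmx1. Qed.

(** The inverse has eigenvalues 1/p and 1/(1 - p) on two orthogonal
    complementary subspaces. *)
Lemma norm2_invmx_mix (w : 'cV[R]_d) :
  norm2 (invmx (p *: (U *m U^T) + (1 - p) *: (V *m V^T)) *m w)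
    <= norm2 w / Num.min p (1 - p).
Proof.
set m := Num.min p (1 - p).
have m0 : 0 < m by rewrite lt_min p0.
apply: ler_norm2; first by rewrite divr_ge0 ?norm2_ge0// ltW.
rewrite invmx_mix expr_div_n sqr_norm2.
set M := _ + _.
have Msym : M^T = M by rewrite /M linearD !linearZ/= !mulmx_tr_sym.
rewrite {1}/dot trmx_mul Msym -mulmxA (mulmxA M) mulmx_mix.
rewrite mulmxDl mulmxDr -!scalemxAl -!scalemxAr.
rewrite mxE [X in X + _]mxE [X in _ + X]mxE.
rewrite -!/(dot _ _) !dot_mulmx_tr.
have -> : dot w w = dot (U^T *m w) (U^T *m w) + dot (V^T *m w) (V^T *m w).
  by rewrite -!dot_mulmx_tr -dotDr -mulmxDl resolution mul1mx.
have bound x : 0 < x -> m <= x -> x^-1 * x^-1 <= (m ^+ 2)^-1.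
  move=> x0 mx; rewrite -invfM lef_pV2 ?posrE ?mulr_gt0// ?exprn_gt0//.
  by rewrite expr2 ler_pM// ltW.
rewrite mulrDl ![_ / m ^+ 2]mulrC lerD// ler_wpM2r ?dot_ge0// bound//.
- by rewrite ge_min lexx.
- by rewrite ge_min lexx orbT.
Qed.

End Mixture.
End Frames.

(** * The step size and the conclusion *)

(** The assumption forces the square root to be positive, hence so is the
    quotient under it; division by 0 having value 0, its denominator, and with it
    tau and d, must be positive.  Since 35^2 is far above 30/6, squaring gives
    the bound with room to spare. *)
Lemma sigma_bound (R : realType) (d : nat) (L tau epsilon p sigma : R) :
  0 < epsilon -> 0 < p < 1 -> 0 < sigma ->
  sigma < 1 / 35 * Num.sqrt
    (epsilon * Num.min p (1 - p) / (tau * d%:R ^+ 3 * Num.max L 1)) ->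
  0 < tau /\ sigma ^+ 2 * tau / 6 * d%:R ^+ 3 * 30 <= epsilon * Num.min p (1 - p).
Proof.
move=> e0 /andP[p0 p1] s0; set m := Num.min _ _; set M := Num.max _ _.
have m0 : 0 < m by rewrite lt_min p0 subr_gt0.
have M1 : 1 <= M by rewrite le_max lexx orbT.
have M0 : 0 < M by apply: lt_le_trans M1.
set D := d%:R ^+ 3; have D0 : 0 <= D by rewrite exprn_ge0.
set X := epsilon * m / _ => sX.
have X0 : 0 < X.
  by rewrite -sqrtr_gt0; lra.
have den0 : 0 < tau * D * M.
  by rewrite -invr_gt0; move: X0; rewrite /X pmulr_rgt0// mulr_gt0.
have tD0 : 0 < tau * D by rewrite -(pmulr_lgt0 _ M0).
have Dpos : 0 < D by rewrite lt0r D0 andbT; apply/eqP => h; rewrite h mulr0 ltxx in tD0.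
have tau0 : 0 < tau by rewrite -(pmulr_lgt0 _ Dpos).
split => //.
have s2 : sigma ^+ 2 <= X / 1225.
  have -> : X / 1225 = (1 / 35 * Num.sqrt X) ^+ 2.
    by rewrite exprMn sqr_sqrtr ?ltW//; field.
  by rewrite lerXn2r ?nnegrE ?ltW// mulr_gt0 ?sqrtr_gt0.
have XE : X * (tau * D * M) = epsilon * m by rewrite /X divfK// gt_eqF.
have : sigma ^+ 2 * (tau * D * M) <= X / 1225 * (tau * D * M).
  by rewrite ler_wpM2r// ltW.
have : sigma ^+ 2 * (tau * D) <= sigma ^+ 2 * (tau * D * M).
  by rewrite ler_wpM2l ?sqr_ge0// ler_peMr// ltW.
have : 0 < epsilon * m by rewrite mulr_gt0.
have : 0 <= sigma ^+ 2 * (tau * D) by rewrite mulr_ge0 ?sqr_ge0// ltW.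
lra.
Qed.

Theorem lemma3p1 (R : realType) (d r : nat)
    (F : 'cV[R]_d -> R) (L tau epsilon p sigma : R)
    (Lact Lperp : {vspace 'cV[R]_d})
    (Uact : 'M[R]_(d, r)) (Uperp : 'M[R]_(d, d - r))
    (Pid Pact Pperp Phat : probability (borel_cV R d) R)
    (hL : lipschitz2 L F) (htau : smooth3 tau sigma F)
    (hepsilon : 0 < epsilon) (hp : 0 < p < 1)
    (hsigma0 : 0 < sigma)
    (hsigma : sigma < 1 / 35 * Num.sqrt
       (epsilon * Num.min p (1 - p) / (tau * d%:R ^+ 3 * Num.max L 1)))
    (hr : \dim Lact = r) (hperp : orthocomplement Lact Lperp)
    (hUact : orthonormal_basis Lact Uact)
    (hUperp : orthonormal_basis Lperp Uperp)
    (hPid : gaussian 1%:M Pid)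
    (hPact : gaussian (Uact *m Uact^T) Pact)
    (hPperp : gaussian (Uperp *m Uperp^T) Pperp)
    (hPhat : mixture p Pact Pperp Phat)
    (theta : 'cV[R]_d) :
  let C1 := mx_expectation Phat (fun g => g *m g^T) in
  norm2 (mx_expectation Pid (grad_base F sigma theta) - gradient F theta)
    <= epsilon /\
  norm2 (mx_expectation Phat (grad_asebo C1 F sigma theta) - gradient F theta)
    <= epsilon.
Proof.
move=> C1.
have [tau0 bound] := sigma_bound hepsilon hp hsigma0 hsigma.
have [p0 p1] := andP hp.
have q0 : 0 < 1 - p by rewrite subr_gt0.
set m := Num.min p (1 - p) in bound.
have m0 : 0 < m by rewrite lt_min p0.
have m1 : m <= 1 by rewrite ge_min ltW.
have rd : (r + (d - r))%N = d.
  by rewrite subnKC// -hr (leq_trans (dimvS (subvf _)))// dimvf /dim /= muln1.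
have UU := orthonormal_tr_mul hUact.
have VV := orthonormal_tr_mul hUperp.
have UV := orthogonal_tr_mul hperp hUact hUperp.
have resolution := orthonormal_resolution rd UU VV UV.
have frame_ge0 k (U : 'M[R]_(d, k)) u : 0 <= dot u (U *m U^T *m u).
  by rewrite dot_mulmx_tr dot_ge0.
have diag_ge0 k (U : 'M[R]_(d, k)) i : 0 <= (U *m U^T) i i.
  have := frame_ge0 k U (delta_mx i ord0).
  by rewrite dot_delta -colE mxE.
(* The diagonal entries of the two covariances are variances, and they sum to 1:
   each is at most 1. *)
have diag1 i : (Uact *m Uact^T) i i + (Uperp *m Uperp^T) i i = 1.
  by move/matrixP : resolution => /(_ i i); rewrite !mxE eqxx.
have Mid : moments 1%:M 30 Pid.
  apply: (gaussian_moments hPid) => [u|i].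
  - by rewrite mul1mx dot_ge0.
  - by rewrite mxE eqxx.
have Mact : moments (Uact *m Uact^T) 30 Pact.
  by apply: (gaussian_moments hPact) => // i; rewrite -(diag1 i) lerDl.
have Mperp : moments (Uperp *m Uperp^T) 30 Pperp.
  by apply: (gaussian_moments hPperp) => // i; rewrite -(diag1 i) lerDr.
have p01 : 0 <= p <= 1 by rewrite !ltW.
have Mhat := mixture_moments hPhat p01 Mact Mperp.
set C := _ + _ in Mhat.
have Csym : C^T = C by rewrite /C linearD !linearZ/= !mulmx_tr_sym.
have K0 : 0 <= 30 :> R by [].
split.
- have := grad_base_bias hsigma0 (ltW tau0) htau Mid (trmx1 _ _) K0 theta.
  rewrite mul1mx => /le_trans; apply; apply: (le_trans bound).
  by rewrite ler_piMr// ltW.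
- have -> : C1 = C by exact: mx_expectation_outer Mhat Csym.
  (* C is moved in front of the gradient, so that the bias of the ASEBO
     estimator appears as C^-1 applied to the bias of the baseline one. *)
  have Cu : C \in unitmx by exact: mix_unitmx UU VV UV resolution hp.
  rewrite (@mx_expectation_mulmxl _ _ _ _ _ _ _ (grad_base F sigma theta)); last first.
    exact: integrable_grad_base hsigma0 (ltW tau0) htau _ _ _ Mhat theta.
  rewrite -[gradient F theta](mulKmx Cu) -mulmxBr.
  apply: le_trans (norm2_invmx_mix UU VV UV resolution hp _) _.
  have bias := grad_base_bias hsigma0 (ltW tau0) htau Mhat Csym K0 theta.
  by rewrite ler_pdivrMr//; apply: le_trans bias bound.
Qed.
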